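(* Let $G=(V,E)$ be a connected undirected graph with $|V|=n$, $\Phi$ its set of spanning trees (as edge sets), $C_e,c_e\in\mathbb{R}$ for $e\in E$, $k$ an integer in $[0,n-1]$, $L=n-1-k$, and fix $\theta\ge 0$. Consider the linear program \[ \phi(\theta)=\min \sum_{e\in E}C_ex_e+\sum_{e\in E}c_ey_e-\theta\sum_{e\in E}z_e+\theta L \] subject to $\sum_{e\in E}x_e=n-1$; $\sum_{e\in E(U)}x_e\le |U|-1$ for all nonempty $U\subseteq V$; $\sum_{e\in E}y_e=n-1$; $\sum_{e\in E(U)}y_e\le |U|-1$ for all nonempty $U\subseteq V$; $x_e-z_e\ge0$, $y_e-z_e\ge 0$, $x_e,y_e,z_e\ge 0$ for all $e\in E$ (here $E(U)$ is the set of edges with both endpoints in $U$). For $X,Y\in\Phi$, the pair $(X,Y)$ denotes the feasible solution with $x_e=1$ iff $e\in X$, $y_e=1$ iff $e\in Y$, $z_e=1$ iff $e\in X\cap Y$ (other values $0$), and let $E_X=X\setminus Y$, $E_Y=Y\setminus X$. If there exist $\alpha_e\ge0,\beta_e\ge0$ with $\alpha_e+\beta_e=\theta$ for each $e\in E$ such that (i) $X$ is a minimum spanning tree for the costs $C_e-\alpha_e$ and $Y$ is a minimum spanning tree for the costs $c_e-\beta_e$, and (ii) $\alpha_e=0$ for each $e\in E_X$ and $\beta_e=0$ for each $e\in E_Y$, then $(X,Y)$ is an optimal solution to this linear program.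
   Context: Conditions (i)–(ii) (with $\alpha_e+\beta_e=\theta$) are called the sufficient pair optimality conditions for $\theta$. *)

(* Defs.v *)
From HB Require Import structures.
From mathcomp Require Import all_boot all_order all_algebra.
Set Implicit Arguments.
Unset Strict Implicit.
Unset Printing Implicit Defensive.
Import Order.TTheory GRing.Theory Num.Theory.
Local Open Scope ring_scope.

(* Finite undirected graphs with an abstract edge type: parallel edges and
   loops (edges with a single endpoint) are allowed.  A simple graph is the
   case where [ends] is injective with two-element values. *)
Record graph := Graph {
  vertex : finType;
  edge : finType;
  ends : edge -> {set vertex};
  ends_card : forall e, (0 < #|ends e| <= 2)%N
}.

Section Graph.
Variable G : graph.
Implicit Types (T : {set edge G}) (U : {set vertex G}).

Definition adj T : rel (vertex G) :=
  fun u v => [exists e in T, ends e == [set u; v]].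

(* The subgraph (V, T) is connected; the empty graph is not. *)
Definition connected_by T : Prop :=
  (0 < #|vertex G|)%N /\ forall u v, connect (adj T) u v.

Definition connected_graph : Prop := connected_by [set: edge G].

(* [vs = v_1 .. v_l] and [es = e_1 .. e_l] form a cycle of (V, T): l >= 1, the
   v_i are distinct, the e_i are distinct edges of T, and e_i joins v_i to
   v_(i+1), with v_(l+1) = v_1.  Loops (l = 1) and pairs of parallel edges
   (l = 2) are cycles. *)
Definition is_cycle T (vs : seq (vertex G)) (es : seq (edge G)) : Prop :=
  [/\ (0 < size vs)%N, uniq vs, uniq es, {subset es <= T} &
      [seq ends e | e <- es] = [seq [set p.1; p.2] | p <- zip vs (rot 1 vs)]].

Definition acyclic T : Prop := forall vs es, ~ is_cycle T vs es.

Definition spanning_tree T : Prop := connected_by T /\ acyclic T.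

Definition edges_in U : {set edge G} := [set e | ends e \subset U].

Section Costs.
Variable R : realFieldType.

Definition min_spanning_tree (w : edge G -> R) T : Prop :=
  spanning_tree T /\
  forall T', spanning_tree T' -> \sum_(e in T) w e <= \sum_(e in T') w e.

Definition in_tree_polytope (x : edge G -> R) : Prop :=
  [/\ \sum_e x e = #|vertex G|%:R - 1,
      forall U, U != set0 -> \sum_(e in edges_in U) x e <= #|U|%:R - 1 &
      forall e, 0 <= x e].

Definition lp_feasible (x y z : edge G -> R) : Prop :=
  [/\ in_tree_polytope x, in_tree_polytope y &
      forall e, [/\ 0 <= x e - z e, 0 <= y e - z e & 0 <= z e]].

Definition lp_objective (C c : edge G -> R) (theta : R) (L : nat)
    (x y z : edge G -> R) : R :=
  \sum_e C e * x e + \sum_e c e * y e - theta * (\sum_e z e) + theta * L%:R.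

Definition lp_optimal (C c : edge G -> R) (theta : R) (L : nat)
    (x y z : edge G -> R) : Prop :=
  lp_feasible x y z /\
  forall x' y' z', lp_feasible x' y' z' ->
    lp_objective C c theta L x y z <= lp_objective C c theta L x' y' z'.

Definition incidence T : edge G -> R := fun e => (e \in T)%:R.

Definition pair_optimal (C c : edge G -> R) (theta : R) (L : nat)
    (X Y : {set edge G}) : Prop :=
  lp_optimal C c theta L (incidence X) (incidence Y) (incidence (X :&: Y)).

Definition sufficient_pair_optimality (C c : edge G -> R) (theta : R)
    (X Y : {set edge G}) (alpha beta : edge G -> R) : Prop :=
  [/\ forall e, [/\ 0 <= alpha e, 0 <= beta e & alpha e + beta e = theta],
      min_spanning_tree (fun e => C e - alpha e) X,
      min_spanning_tree (fun e => c e - beta e) Y,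
      forall e, e \in X :\: Y -> alpha e = 0 &
      forall e, e \in Y :\: X -> beta e = 0].

End Costs.
End Graph.

(* Main.v *)
(* Edmonds' theorem by the greedy argument: if T is a minimum spanning tree for
   w, the exchange property shows that every edge with w e <= t joins two
   vertices of the same component of T_t = {f in T | w f <= t}.  Summing the
   constraints x(E(U)) <= |U| - 1 over those components gives
   x({w <= t}) <= |T_t| for every polytope point x, and summation by parts over
   t gives w(T) <= w . x.  The theorem is then weak duality: z <= x, z <= y and
   alpha + beta = theta give theta z <= alpha x + beta y, and condition (ii)
   turns this into an equality at (X, Y). *)
Require Import Defs.
From HB Require Import structures.
From mathcomp Require Import all_boot all_order all_algebra.
From mathcomp Require Import fingraph zify ring lra.
Set Implicit Arguments.
Unset Strict Implicit.
Unset Printing Implicit Defensive.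
Import Order.TTheory GRing.Theory Num.Theory.
Local Open Scope ring_scope.

(** * Components of edge subsets and their number *)

Section Connectivity.
Variable G : graph.
Implicit Types (S T : {set edge G}) (U : {set vertex G}) (e f : edge G).
Implicit Types (u v a b : vertex G).

Definition ncomp S : nat := n_comp (adj S) predT.

Lemma edge_endsP e : exists a b, ends e = [set a; b].
Proof.
have /andP[h0] := ends_card e; rewrite leq_eqVlt => /orP[/cards2P[a [b [_ ->]]]|h1].
  by exists a, b.
have /cards1P[a ->] : #|ends e| == 1%N by lia.
by exists a, a; rewrite setUid.
Qed.

Lemma adj_sym S : symmetric (adj S).
Proof. by move=> u v; rewrite /adj setUC. Qed.

Lemma conn_sym S : connect_sym (adj S).
Proof. exact/sym_connect_sym/adj_sym. Qed.

Lemma adj_edge S e a b : e \in S -> ends e = [set a; b] -> adj S a b.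
Proof. by move=> eS he; apply/existsP; exists e; rewrite eS he eqxx. Qed.

Lemma connectS S T u v :
  S \subset T -> connect (adj S) u v -> connect (adj T) u v.
Proof.
move=> /subsetP sST; apply: connect_sub => {}u {}v /existsP[e /andP[/sST eT he]].
by apply/connect1/existsP; exists e; rewrite eT.
Qed.

(** Induction on the path: when it starts by crossing [f], the case for the tail tells from which
    endpoint of [f] the vertex [v] is reached within [S], so at most one crossing is kept. *)
Lemma connect_setU1 S f a b u v : ends f = [set a; b] ->
  connect (adj (f |: S)) u v ->
  [|| connect (adj S) u v, connect (adj S) u a && connect (adj S) b v
    | connect (adj S) u b && connect (adj S) a v].
Proof.
move=> hf /connectP[p]; elim: p u => [|w p IHp] u /=.
  by move=> _ ->; rewrite connect0.
move=> /andP[/existsP[e /andP[]]]; rewrite in_setU1 => /orP[/eqP->|eS] /eqP he hp hv.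
  have {he} : (u == a) && (w == b) || (u == b) && (w == a).
    have : u \in ends f by rewrite he set21.
    have : w \in ends f by rewrite he set22.
    have : a \in [set u; w] by rewrite -he hf set21.
    have : b \in [set u; w] by rewrite -he hf set22.
    rewrite hf !in_set2 (eq_sym a) (eq_sym b) (eq_sym a w) (eq_sym b w).
    by do 4!case: eqP => //= _.
  case/orP=> /andP[/eqP-> /eqP hw]; move: (IHp _ hp hv); rewrite {}hw.
    case/or3P=> [-> | /andP[_ ->] | /andP[_ ->]]; rewrite ?connect0 ?orbT //.
  case/or3P=> [-> | /andP[_ ->] | /andP[_ ->]]; rewrite ?connect0 ?orbT //.
have huw : connect (adj S) u w by apply/connect1/adj_edge/he.
case/or3P: (IHp _ hp hv) => [h | /andP[h ->] | /andP[h ->]];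
  by rewrite (connect_trans huw h) ?orbT.
Qed.

Lemma ncomp_set0 : ncomp set0 = #|vertex G|.
Proof.
apply: eq_card => u; rewrite !inE andbT; apply/eqP.
have /connectP[[|w p] //=] := connect_root (adj set0) u.
by case/andP=> /existsP[e]; rewrite inE.
Qed.

Lemma root_roots S u : root (adj S) u \in roots (adj S).
Proof. exact: (roots_root (conn_sym S)). Qed.

Lemma root_idE S u : u \in roots (adj S) -> root (adj S) u = u.
Proof. by move/eqP. Qed.

Lemma ncompE S : ncomp S = #|roots (adj S)|.
Proof. by apply: eq_card => u; rewrite !inE andbT. Qed.

(** An edge merges at most two components: sending old roots to new ones is injective once the root
    of [b] is left out. *)
Lemma ncomp_setU1_ge S f : (ncomp S <= (ncomp (f |: S)).+1)%N.
Proof.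
have [a [b hf]] := edge_endsP f.
set r := root (adj S); set r' := root (adj (f |: S)).
have inj : {in [predD1 roots (adj S) & r b] &, injective r'}.
  move=> x y /andP[/= xb xr] /andP[/= yb yr] /eqP.
  rewrite root_connect; last exact: conn_sym.
  have hr z t : z \in roots (adj S) -> connect (adj S) z t -> z = r t.
    by move=> zr; rewrite -(root_connect (conn_sym S)) root_idE // => /eqP.
  case/(connect_setU1 hf)/or3P=> [h | /andP[_ h] | /andP[h _]].
  - by rewrite (hr x y) // /r root_idE.
  - by rewrite conn_sym in h; rewrite (hr _ _ yr h) eqxx in yb.
  - by rewrite (hr _ _ xr h) eqxx in xb.
rewrite !ncompE (cardD1 (r b)) root_roots add1n ltnS -(card_in_imset inj).
apply: subset_leq_card; apply/subsetP => x /imsetP[y _ ->].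
exact: root_roots.
Qed.

Lemma ncomp_setU1_lt S f a b : ends f = [set a; b] ->
  ~~ connect (adj S) a b -> (ncomp (f |: S) < ncomp S)%N.
Proof.
move=> hf nab.
set r := root (adj S); set r' := root (adj (f |: S)).
have ab : connect (adj (f |: S)) a b by apply/connect1/(adj_edge _ hf)/setU11.
have rr x : r' (r x) = r' x.
  apply/eqP; rewrite root_connect; last exact: conn_sym.
  by apply: (connectS (subsetUr _ _)); rewrite conn_sym connect_root.
rewrite !ncompE (cardD1 (r b) (roots (adj S))) root_roots add1n ltnS.
apply: leq_trans (leq_imset_card r' _); apply: subset_leq_card.
apply/subsetP => z zr; apply/imsetP.
(* The root of [b] was discarded; the root of [a] now represents its component. *)
have [zb|zb] := eqVneq (r z) (r b).
  exists (r a).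
    apply/andP; split=> /=; last exact: root_roots.
    by rewrite root_connect //; exact: conn_sym.
  rewrite rr -(root_idE zr) -/r' -[LHS]rr zb rr.
  by apply/eqP; rewrite eq_sym root_connect //; exact: conn_sym.
exists (r z); last by rewrite rr /r' root_idE.
by apply/andP; split=> //=; exact: root_roots.
Qed.

(** Starting from isolated vertices, each edge lowers the number of components by at most one. *)
Lemma leq_card_ncomp S : (#|vertex G| <= #|S| + ncomp S)%N.
Proof.
have [m] := ubnP #|S|; elim: m S => // m IHm S.
have [->|[f fS]] := set_0Vmem S; first by rewrite cards0 ncomp_set0.
rewrite (cardsD1 f) fS => hm.
have := IHm (S :\ f) ltac:(lia).
by have := ncomp_setU1_ge (S :\ f) f; rewrite setD1K //; lia.
Qed.

(** * Forests and spanning trees: cycles, edge counts, exchange *)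

Lemma acyclicS S T : S \subset T -> acyclic T -> acyclic S.
Proof.
move=> /subsetP sST ac vs es [h1 h2 h3 h4 h5]; apply: (ac vs es); split=> //.
by move=> e /h4/sST.
Qed.

Lemma zip_rcons_cons (A : Type) (x y : A) (p : seq A) :
  zip (x :: p) (rcons p y) = rcons (zip (x :: p) p) (last x p, y).
Proof. by elim: p x => //= z p IHp x; rewrite -IHp. Qed.

(** The clause on endpoints carries the induction for distinctness: the first edge contains [a],
    which does not recur on the path, so it differs from all later edges. *)
Lemma path_edges S a p : path (adj S) a p -> uniq (a :: p) ->
  exists es, [/\ uniq es, {subset es <= S},
    {in es, forall e, {subset ends e <= a :: p}} &
    [seq ends e | e <- es] = [seq [set q.1; q.2] | q <- zip (a :: p) p]].
Proof.
elim: p a => [|b p IHp] a; first by exists [::].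
rewrite [path _ _ _]/= [uniq _]/=.
case/andP=> /existsP[e /andP[eS /eqP he]] /IHp{}IHp /andP[ap].
case/IHp=> es [ues ses ins hes].
exists (e :: es); split.
- rewrite cons_uniq ues andbT; apply: contra ap => /ins; apply.
  by rewrite he set21.
- by move=> g; rewrite inE => /orP[/eqP->|/ses].
- move=> g; rewrite inE => /orP[/eqP->|/ins h] x.
    by rewrite he !inE => /orP[] ->; rewrite ?orbT.
  by move/h => xbp; rewrite in_cons xbp orbT.
- by rewrite /= he hes.
Qed.

Lemma edges_path S a p es : {subset es <= S} ->
  [seq ends e | e <- es] = [seq [set q.1; q.2] | q <- zip (a :: p) p] ->
  path (adj S) a p.
Proof.
elim: p a es => [|b p IHp] a [|e es] //= ses [he hes].
rewrite (adj_edge (ses _ (mem_head _ _)) he) (IHp _ es) // => g ges.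
by apply: ses; rewrite inE ges orbT.
Qed.

(** A path from [a] to [b] avoiding [e], shortened to distinct vertices, would be closed by [e] into
    a cycle. *)
Lemma acyclic_bridge T e a b : acyclic T -> e \in T -> ends e = [set a; b] ->
  ~~ connect (adj (T :\ e)) a b.
Proof.
move=> ac eT he; apply/negP => /connectP[p0 /shortenP[p hp up _] hb].
have [es [ues ses _ hes]] := path_edges hp up.
apply: (ac (a :: p) (rcons es e)); split=> //.
- rewrite rcons_uniq ues andbT; apply/negP => /ses.
  by rewrite !inE eqxx.
- by move=> g; rewrite mem_rcons inE => /orP[/eqP->|/ses /setD1P[]].
- rewrite map_rcons hes he hb rot1_cons zip_rcons_cons map_rcons /=.
  by rewrite setUC.
Qed.

(** The last edge of the cycle closes the path formed by the others. *)
Lemma cycle_edge T vs es : is_cycle T vs es ->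
  exists e a b, [/\ e \in T, ends e = [set a; b] & connect (adj (T :\ e)) a b].
Proof.
case: vs => [|a p] [// _ _ ues ses].
rewrite rot1_cons zip_rcons_cons map_rcons.
case/lastP: es ues ses => [|es e] ues ses.
  by move=> /(congr1 size); rewrite size_rcons.
rewrite map_rcons => /rcons_inj[hes he].
exists e, (last a p), a; split=> //; first by apply: ses; rewrite mem_rcons mem_head.
rewrite conn_sym; apply/connectP; exists p => //; apply: edges_path hes => g ges.
move: ues; rewrite rcons_uniq !inE => /andP[ees _].
rewrite ses ?mem_rcons ?inE ?ges ?orbT // andbT.
by apply: contraNneq ees => <-.
Qed.

(** Every edge of a forest is a bridge, so each one strictly lowers the number of components. *)
Lemma acyclic_ncomp T : acyclic T -> (#|T| + ncomp T <= #|vertex G|)%N.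
Proof.
have [m] := ubnP #|T|; elim: m T => // m IHm T.
have [->|[f fT]] := set_0Vmem T; first by rewrite cards0 ncomp_set0.
rewrite (cardsD1 f) fT => hm ac; have [a [b hf]] := edge_endsP f.
have := IHm (T :\ f) ltac:(lia) (acyclicS (subD1set _ _) ac).
have := ncomp_setU1_lt hf (acyclic_bridge ac fT hf).
by rewrite setD1K //; lia.
Qed.

Lemma connected_ncomp T : connected_by T -> ncomp T = 1%N.
Proof.
case=> /card_gt0P[u _] conn; rewrite ncompE.
rewrite -(card1 (root (adj T) u)); apply: eq_card => v; rewrite [RHS]inE.
apply/idP/eqP => [vr | ->]; last exact: root_roots.
by rewrite -(root_idE vr); apply/eqP; rewrite root_connect //; exact: conn_sym.
Qed.

Lemma card_spanning_tree T : spanning_tree T -> #|vertex G| = #|T|.+1.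
Proof.
case=> conn /acyclic_ncomp; have := leq_card_ncomp T.
by rewrite (connected_ncomp conn); lia.
Qed.

(** Deleting an edge of a cycle would leave a connected graph with only [#|vertex G| - 2] edges. *)
Lemma spanning_tree_card T :
  connected_by T -> #|vertex G| = #|T|.+1 -> spanning_tree T.
Proof.
move=> conn hn; split=> // vs es /cycle_edge[e [a [b [eT he hab]]]].
have cT' : connected_by (T :\ e).
  case: conn => n0 conn; split=> // u v; have := conn u v.
  rewrite -{1}(setD1K eT) => /(connect_setU1 he).
  case/or3P=> // /andP[h1 h2]; apply: connect_trans h1 (connect_trans _ h2) => //.
  by rewrite conn_sym.
have := leq_card_ncomp (T :\ e); rewrite (connected_ncomp cT').
by have := cardsD1 e T; rewrite eT; lia.
Qed.

(** The edges inside [U] leave every vertex outside [U] isolated, so they form at least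
    [#|~: U| + 1] components; the edge count of forests concludes. *)
Lemma acyclic_card_in T U : acyclic T -> U != set0 ->
  (#|T :&: edges_in U| < #|U|)%N.
Proof.
move=> ac /set0Pn[u uU]; set S := T :&: _.
have iso x y : x \notin U -> connect (adj S) x y -> x = y.
  move=> xU /connectP[[|z p] //= /andP[/existsP[e /andP[]]]].
  rewrite !inE => /andP[_ /subsetP sU] /eqP he.
  by case/negP: xU; apply: sU; rewrite he set21.
have sub : root (adj S) u |: ~: U \subset roots (adj S).
  apply/subsetP => x; rewrite !inE => /orP[/eqP->|xU]; first exact: root_roots.
  by apply/eqP; rewrite -(iso _ _ xU (connect_root _ _)).
have := subset_leq_card sub; rewrite cardsU1 !inE negbK.
have -> : root (adj S) u \in U.
  apply/negP => /negP rU; suff : root (adj S) u = u by move=> h; rewrite h uU in rU.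
  by apply: iso => //; rewrite conn_sym connect_root.
rewrite -ncompE; have := acyclic_ncomp (acyclicS (subsetIl _ _) ac : acyclic S).
by have := cardsC U; rewrite /S; lia.
Qed.

(** Some edge [f] of the path joining [a] and [b] in [T] lies outside [F]; once removed, it is
    bypassed by [e] and the rest of that path. *)
Lemma spanning_tree_exchange T (F : {set edge G}) e a b :
  spanning_tree T -> F \subset T -> ends e = [set a; b] -> ~~ connect (adj F) a b -> e \notin T ->
  exists2 f, f \in T :\: F & spanning_tree (e |: T :\ f).
Proof.
move=> sT FT he nab eT; have [[n0 conn] _] := sT.
pose P (M : {set edge G}) := connect (adj M) a b.
(* A minimal subset of [T] connecting [a] and [b] stands for the edge set of the tree path. *)
have [M /minsetP[PM minM] MT] := minset_exists (conn a b : P T).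
have [f fM fF] : exists2 f, f \in M & f \notin F.
  apply/subsetPn; apply/negP => MF.
  by rewrite (connectS MF PM) in nab.
have fT := subsetP MT _ fM.
exists f; first by rewrite inE fF.
have [c [d hf]] := edge_endsP f.
set S := e |: T :\ f.
have MS x y : connect (adj (M :\ f)) x y -> connect (adj S) x y.
  apply: connectS; apply: subset_trans (setSD _ MT) _; exact: subsetUr.
have ba : connect (adj S) b a.
  by rewrite conn_sym; apply/connect1/(adj_edge _ he)/setU11.
have cd : connect (adj S) c d.
  (* By minimality [M] without [f] separates [a] from [b], so the endpoints of [f] are linked one to
     [a] and the other to [b], and [e] completes the detour. *)
  have nM : ~~ P (M :\ f).
    apply/negP => /minM/(_ (subD1set _ _)) h.
    by move: fM; rewrite -h !inE eqxx.
  move: PM; rewrite /P -(setD1K fM) => /(connect_setU1 hf).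
  rewrite -[connect _ a b]/(P _) (negPf nM) /=.
  case/orP=> /andP[/MS h1 /MS h2].
    by rewrite conn_sym; apply: connect_trans h2 (connect_trans ba h1).
  exact: connect_trans h2 (connect_trans ba h1).
(* The edge count is unchanged, so connectivity suffices. *)
apply: spanning_tree_card; last first.
  rewrite (card_spanning_tree sT) /S cardsU1 !inE (negPf eT) andbF /=.
  by rewrite (cardsD1 f T) fT.
split=> // u v; have := conn u v; rewrite -(setD1K fT) => /(connect_setU1 hf).
have TS x y : connect (adj (T :\ f)) x y -> connect (adj S) x y.
  by apply: connectS; apply: subsetUr.
case/or3P=> [/TS //|/andP[/TS h1 /TS h2]|/andP[/TS h1 /TS h2]].
  exact: connect_trans h1 (connect_trans cd h2).
by rewrite conn_sym in cd; exact: connect_trans h1 (connect_trans cd h2).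
Qed.

End Connectivity.

(** * Spanning tree polytope and optimality of greedy trees *)

Section Polytope.
Variables (R : realFieldType) (G : graph).
Implicit Types (w x : edge G -> R) (T F A : {set edge G}).

Lemma sum_incidence A T w :
  \sum_(e in A) w e * incidence R T e = \sum_(e in A :&: T) w e.
Proof.
rewrite big_mkcond [RHS]big_mkcond; apply: eq_bigr => e _.
by rewrite inE /incidence mulr_natr mulrb; case: (e \in A).
Qed.

Lemma sum_incidence1 A T : \sum_(e in A) incidence R T e = #|A :&: T|%:R.
Proof.
rewrite -sum1_card natr_sum -sum_incidence.
by apply: eq_bigr => e _; rewrite mul1r.
Qed.

Lemma spanning_tree_polytope T : spanning_tree T -> in_tree_polytope (incidence R T).
Proof.
move=> sT; split=> [|U U0|e]; last exact: ler0n.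
  rewrite (card_spanning_tree sT) -natr1 addrK -[in RHS](setTI T) -sum_incidence1.
  by apply: eq_bigl => e; rewrite inE.
rewrite sum_incidence1 setIC lerBrDr natr1 ler_nat.
by apply: acyclic_card_in => //; case: sT.
Qed.

(** Grouping the edges of [A] by component of [F], the bounds [#|K u| - 1] add up to
    [#|vertex G| - ncomp F], which is at most [#|F|]. *)
Lemma polytope_sum_le_card x A F : in_tree_polytope x ->
  (forall e, e \in A -> {in ends e &, forall a b, connect (adj F) a b}) ->
  \sum_(e in A) x e <= #|F|%:R.
Proof.
move=> [_ xU x0] AF.
(* A chosen endpoint [s e] assigns each edge to a component. *)
have [s sP] : exists s : edge G -> vertex G, forall e, s e \in ends e.
  apply: (@fin_all_exists _ (fun=> vertex G) (fun e v => v \in ends e)) => e.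
  have [a [b ->]] := edge_endsP e.
  by exists a; rewrite set21.
pose r := root (adj F).
have rP v : true -> r v \in roots (adj F) by rewrite root_roots.
have -> : \sum_(e in A) x e
    = \sum_(u in roots (adj F)) \sum_(e in A | r (s e) == u) x e.
  by apply: (partition_big (r \o s)) => e _; apply: rP.
pose K u := [set v | r v == u].
apply: (@le_trans _ _ (\sum_(u in roots (adj F)) (#|K u|%:R - 1))).
  apply: ler_sum => u uF.
  (* Nonnegativity of [x] allows enlarging the group to all edges inside the component. *)
  apply: (@le_trans _ _ (\sum_(e in edges_in (K u)) x e)); last first.
    by apply/xU/set0Pn; exists u; rewrite inE /r root_idE.
  rewrite big_mkcond [leRHS]big_mkcond; apply: ler_sum => e _.
  case: ifP => [/andP[eA /eqP es]|_]; last by case: ifP.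
  suff -> : e \in edges_in (K u) by [].
  rewrite inE; apply/subsetP => v ve; rewrite inE -es root_connect.
    exact: (AF e).
  exact: conn_sym.
rewrite sumrB -natr_sum sumr_const lerBlDr -natrD ler_nat -ncompE.
apply: leq_trans (leq_card_ncomp F).
rewrite -sum1_card [leqRHS](partition_big r (mem (roots (adj F)))) //=.
apply: leq_sum => u _; rewrite -sum1_card.
by rewrite big_mkcond [leqRHS]big_mkcond; apply: leq_sum => v _; rewrite inE.
Qed.

(** Otherwise the exchange property gives [f] in [T] with [w f > t >= w e], and the swap produces a
    cheaper tree. *)
Lemma min_spanning_tree_threshold w T t e : min_spanning_tree w T ->
  w e <= t -> {in ends e &, forall a b,
    connect (adj [set f in T | w f <= t]) a b}.
Proof.
move=> [sT minT] wet; set F := [set f in T | _].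
have [a [b he]] := edge_endsP e.
suff ab : connect (adj F) a b.
  move=> u v; rewrite he !inE => /orP[]/eqP-> /orP[]/eqP->; rewrite ?connect0 //.
  by rewrite conn_sym.
have [eT|eT] := boolP (e \in T).
  by apply/connect1/(adj_edge _ he); rewrite inE eT.
apply/negPn/negP => nab.
have FT : F \subset T by apply/subsetP => f; rewrite inE => /andP[].
have [f] := spanning_tree_exchange sT FT he nab eT.
rewrite !inE => /andP[+ fT] /minT; rewrite fT /= -ltNge => wft.
rewrite big_setU1 /=; last by rewrite !inE (negPf eT) andbF.
rewrite (big_setD1 f fT) /= lerD2r => wfe.
by have := lt_le_trans (le_lt_trans wet wft) wfe; rewrite ltxx.
Qed.

(* Abel summation along the sublevel sets of [w], by induction on their size. *)
Lemma sum_mul_ge0 (I : finType) (w d : I -> R) :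
  (forall t, \sum_(i | w i <= t) d i <= 0) -> \sum_i d i = 0 ->
  0 <= \sum_i w i * d i.
Proof.
move=> dle d0.
(* This sum is minus the integral up to [t] of the sublevel sums of [d]; a large [t] will give the
   claim. *)
have H t : 0 <= \sum_(i | w i < t) (w i - t) * d i.
  have [m] := ubnP #|[pred i | w i < t]|; elim: m t => // m IHm t hm.
  case: (pickP [pred i | w i < t]) => [i0 /= i0t|none]; last by rewrite big_pred0.
  case: (@arg_maxP _ _ _ i0 (fun i => w i < t) w i0t) => i it imax.
  have wt j : (w j < t) = (w j <= w i).
    by apply/idP/idP => [/imax //|h]; apply: le_lt_trans h it.
  (* Since [w i] is the largest value below [t], lowering the threshold to [w i] splits off a single
     sublevel sum; terms with [w j = w i] vanish from what remains. *)
  have -> : \sum_(j | w j < t) (w j - t) * d j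
      = \sum_(j | w j < w i) (w j - w i) * d j
        + (w i - t) * \sum_(j | w j <= w i) d j.
    rewrite mulr_sumr big_mkcond [X in _ = X + _]big_mkcond.
    rewrite [X in _ = _ + X]big_mkcond -big_split; apply: eq_bigr => j _ /=.
    by rewrite wt; case: ltgtP => [_|_|->] /=; ring.
  apply: addr_ge0; last by apply: mulr_le0; rewrite ?dle // subr_le0 ltW.
  apply: IHm; rewrite ltnS (cardD1 i) inE it in hm; apply: leq_trans hm.
  rewrite ltnS; apply/subset_leq_card/subsetP => j; rewrite !inE => ji.
  by rewrite (lt_trans ji it) andbT; apply: contraTneq ji => ->; rewrite ltxx.
(* This threshold exceeds every [w i], and its own contribution vanishes because [d] sums to
   zero. *)
have := H (1 + \sum_i `|w i|).
rewrite (eq_bigl xpredT) => [|i]; last first.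
  rewrite (bigD1 i) //=; have := ler_norm (w i).
  have : 0 <= \sum_(j | j != i) `|w j| by apply: sumr_ge0.
  by move=> h1 h2; apply/idP; lra.
under eq_bigr do rewrite mulrBl.
by rewrite sumrB -mulr_sumr d0 mulr0 subr0.
Qed.

(** Summation by parts is applied to [x] minus the incidence vector of [T]: its total is zero, and
    the component bound makes its sublevel sums nonpositive. *)
Lemma min_spanning_tree_polytope w T x :
  min_spanning_tree w T -> in_tree_polytope x ->
  \sum_e w e * incidence R T e <= \sum_e w e * x e.
Proof.
move=> mT xP; rewrite -subr_ge0 -sumrB.
under eq_bigr do rewrite -mulrBr.
have [sT _] := mT.
apply: sum_mul_ge0 => [t|]; last first.
  have [[x1 _ _] [T1 _ _]] := (xP, spanning_tree_polytope sT).
  by rewrite sumrB x1 T1 subrr.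
rewrite sumrB subr_le0.
have setE (y : edge G -> R) :
    \sum_(e | w e <= t) y e = \sum_(e in [set e | w e <= t]) y e.
  by apply: eq_bigl => e; rewrite inE.
rewrite !setE sum_incidence1 setIC -setIdE.
by apply: polytope_sum_le_card => // e; rewrite inE; apply: min_spanning_tree_threshold.
Qed.

End Polytope.

(** * Weak duality for the linear program *)

Theorem theorem2 (R : realFieldType) (G : graph) (hG : connected_graph G)
    (C c : edge G -> R) (k : nat) (hk : (k <= #|vertex G| - 1)%N)
    (theta : R) (htheta : 0 <= theta)
    (X Y : {set edge G}) (hX : spanning_tree X) (hY : spanning_tree Y) :
  (exists alpha beta : edge G -> R,
      sufficient_pair_optimality C c theta X Y alpha beta) ->
  pair_optimal C c theta (#|vertex G| - 1 - k)%N X Y.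
Proof.
move=> [alpha [beta [ab mX mY aX bY]]]; split.
  split; try exact: spanning_tree_polytope.
  move=> e; rewrite /incidence inE ler0n !subr_ge0 !ler_nat.
  by case: (e \in X); case: (e \in Y).
move=> x y z [xP yP xyz]; rewrite /lp_objective lerD2r.
(* The middle term is the total reduced cost of both trees. It agrees with the objective edge by
   edge: on [X :&: Y] since [alpha e + beta e = theta], elsewhere by condition (ii). *)
apply: (@le_trans _ _ (\sum_e (C e - alpha e) * incidence R X e
                       + \sum_e (c e - beta e) * incidence R Y e)).
  rewrite mulr_sumr -!big_split -sumrB; apply: ler_sum => e _ /=.
  have [_ _ <-] := ab e; move: (aX e) (bY e); rewrite /incidence !inE.
  case: (e \in X); case: (e \in Y) => /= ha hb; rewrite ?(mulr1, mulr0).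
  - lra.
  - by rewrite ha //; lra.
  - by rewrite hb //; lra.
  - lra.
apply: le_trans (lerD (min_spanning_tree_polytope mX xP)
                      (min_spanning_tree_polytope mY yP)) _.
rewrite mulr_sumr -!big_split -sumrB; apply: ler_sum => e _ /=.
(* The two sides differ by [alpha e * (x e - z e) + beta e * (y e - z e)]. *)
have [a0 b0 <-] := ab e; have [xz yz _] := xyz e.
have := mulr_ge0 a0 xz; have := mulr_ge0 b0 yz; lra.
Qed.
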